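(* Let $\mathrm{X}\in\{\mathrm{A},\mathrm{B},\mathrm{C},\mathrm{D}\}$ and let $\iota$ be an infinite sequence of indices adapted to the Cartan matrix of type $\mathrm{X}_n$. Then $\iota$ satisfies the positivity condition: for every $\varphi=\sum_{k}\varphi_kx_k\in\Xi_{\iota}$ and every $k\geq1$ with $k^{(-)}=0$, one has $\varphi_k\geq0$.
   Context: **Lie algebra.** $\mathfrak g$ is the finite-dimensional simple Lie algebra of type $\mathrm{X}_n$ ($\mathrm A_n$: $n\ge1$; $\mathrm B_n,\mathrm C_n$: $n\ge2$; $\mathrm D_n$: $n\ge4$), $I=\{1,\dots,n\}$, with Cartan matrix $a_{i,j}=\langle h_i,\alpha_j\rangle$ in Kac's convention: $a_{i,i}=2$; type $\mathrm A_n$: $a_{i,j}=-1$ if $|i-j|=1$; type $\mathrm B_n$: as $\mathrm A_n$ except $a_{n,n-1}=-2$; type $\mathrm C_n$: as $\mathrm A_n$ except $a_{n-1,n}=-2$; type $\mathrm D_n$: $a_{i,j}=-1$ if $|i-j|=1$ and $i,j\le n-1$, and $a_{n,n-2}=a_{n-2,n}=-1$; all other entries are $0$. **Adapted sequence.** $\iota=(\dots,i_3,i_2,i_1)$ is an infinite sequence in $I$ (written right to left) with $i_k\neq i_{k+1}$ for all $k\geq 1$ and $\#\{k: i_k=i\}=\infty$ for every $i\in I$. It is adapted to the Cartan matrix if for all $i\neq j$ in $I$ with $a_{i,j}\neq0$ the subsequence of $\iota$ consisting of all $i$'s and $j$'s is $(\dots,i,j,i,j)$ or $(\dots,j,i,j,i)$.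 **Operators.** $\mathbb{Q}^{\infty}=\{(\dots,a_2,a_1): a_k\in\mathbb{Q},\ a_k=0 \text{ for } k\gg0\}$, $(\mathbb{Q}^{\infty})^*=\mathrm{Hom}(\mathbb{Q}^{\infty},\mathbb{Q})$, and $x_k\in(\mathbb{Q}^\infty)^*$ ($k\ge1$) is the coordinate function $x_k(\dots,a_2,a_1)=a_k$. For $k\geq1$ put $k^{(+)}=\min\{l>k: i_l=i_k\}$ and $k^{(-)}=\max\{l<k: i_l=i_k\}$ if it exists, $k^{(-)}=0$ otherwise. Put $\beta_0=0$ and $\beta_k=x_k+\sum_{k<j<k^{(+)}}\langle h_{i_k},\alpha_{i_j}\rangle x_j+x_{k^{(+)}}$. For $\varphi=\sum_k\varphi_kx_k$ put $S_k(\varphi)=\varphi-\varphi_k\beta_k$ if $\varphi_k>0$ and $S_k(\varphi)=\varphi-\varphi_k\beta_{k^{(-)}}$ if $\varphi_k\leq0$. Finally $\Xi_{\iota}=\{S_{j_l}\cdots S_{j_1}x_{j_0} : l\geq0,\ j_0,\dots,j_l\geq1\}$. *)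

(* Defs.v *)
From HB Require Import structures.
From mathcomp Require Import all_boot all_order all_algebra.

Set Implicit Arguments.
Unset Strict Implicit.
Unset Printing Implicit Defensive.

Import Order.TTheory GRing.Theory Num.Theory.
Local Open Scope ring_scope.

Inductive cartan_type := TypeA | TypeB | TypeC | TypeD.

Definition valid_rank (X : cartan_type) (n : nat) : bool :=
  match X with
  | TypeA => (1 <= n)%N
  | TypeB | TypeC => (2 <= n)%N
  | TypeD => (4 <= n)%N
  end.

Definition adjacent (i j : nat) : bool := (i == j.+1) || (j == i.+1).

(* Here the labels i, j run over 1, ..., n. *)
Definition cartanA (i j : nat) : int :=
  if i == j then 2 else if adjacent i j then - 1 else 0.

Definition cartan_entry (X : cartan_type) (n i j : nat) : int :=
  match X with
  | TypeA => cartanA i j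
  | TypeB => if (i == n) && (j == n.-1) then - 2 else cartanA i j
  | TypeC => if (i == n.-1) && (j == n) then - 2 else cartanA i j
  | TypeD =>
      if i == j then 2
      else if [&& adjacent i j, (i <= n.-1)%N & (j <= n.-1)%N] then - 1
      else if (i == n) && (j == n.-2) || (i == n.-2) && (j == n) then - 1
      else 0
  end.

(* The label i of I = {1, ..., n} is the element of 'I_n of value i - 1. *)
Definition cartan (X : cartan_type) (n : nat) : 'M[int]_n :=
  \matrix_(i < n, j < n) cartan_entry X n i.+1 j.+1.

(* Positions are numbered from 1, and the value at 0 is irrelevant; [ix_inf]
   says that each index occurs at arbitrarily large positions. *)
Record index_seq (n : nat) := IndexSeq {
  ix :> nat -> 'I_n;
  ix_neq : forall k, (0 < k)%N -> ix k != ix k.+1;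
  ix_inf : forall i m, exists k, (m < k)%N && (ix k == i)
}.

(* The occurrences of i and j at the positions 1, ..., N, with position 1 on
   the left: this is the reverse of the right-to-left display of sequences. *)
Definition subseq_upto (n : nat) (s : index_seq n) (i j : 'I_n) (N : nat) :
    seq 'I_n :=
  [seq a <- [seq s k | k <- index_iota 1 N.+1] | (a == i) || (a == j)].

Definition alternates (T : Type) (a b : T) (w : seq T) : Prop :=
  w = mkseq (fun m => if odd m then b else a) (size w).

Definition adapted (X : cartan_type) (n : nat) (s : index_seq n) : Prop :=
  forall i j : 'I_n, i != j -> cartan X n i j != 0 ->
    (forall N, alternates i j (subseq_upto s i j N)) \/
    (forall N, alternates j i (subseq_upto s i j N)).

(* A polynomial is the finitely supported sequence of its coefficients: a_k is
   the coefficient of degree k - 1, as positions start at 1. *)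
Definition Qinf : lmodType rat := {poly rat}.

Definition Qdual := {linear Qinf -> rat^o}.

Definition dzero : Qdual := \0.
Definition dadd (f g : Qdual) : Qdual := f \+ g.
Definition dopp (f : Qdual) : Qdual := \- f.
Definition dscale (c : rat) (f : Qdual) : Qdual := c \*: f.

(* For k >= 1. *)
Definition x_ (k : nat) : Qdual := coefp k.-1.

(* phi = \sum_k phi_k x_k, where phi_k is the value of phi at the k-th vector
   of the standard basis of Qinf. *)
Definition dcoef (phi : Qdual) (k : nat) : rat := phi ('X^(k.-1) : {poly rat}).

Section Operators.
Variables (X : cartan_type) (n : nat) (s : index_seq n).

Definition kplus (k : nat) : nat := ex_minn (ix_inf s (s k) k).

(* The maximum of an empty family is 0. *)
Definition kminus (k : nat) : nat := \max_(1 <= l < k | s l == s k) l.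

Definition beta (k : nat) : Qdual :=
  if k == 0%N then dzero
  else dadd (dadd (x_ k)
    (\big[dadd/dzero]_(k.+1 <= j < kplus k)
        dscale (cartan X n (s k) (s j))%:~R (x_ j)))
    (x_ (kplus k)).

Definition S_ (k : nat) (phi : Qdual) : Qdual :=
  let c := dcoef phi k in
  if 0 < c then dadd phi (dopp (dscale c (beta k)))
  else dadd phi (dopp (dscale c (beta (kminus k)))).

(* [js] lists j_1, ..., j_l, so that S_(j_1) is applied first. *)
Definition Xi (phi : Qdual) : Prop :=
  exists (j0 : nat) (js : seq nat),
    [/\ (1 <= j0)%N, all (leq 1) js &
        phi = foldl (fun psi j => S_ j psi) (x_ j0) js].

Definition positivity_condition : Prop :=
  forall phi, Xi phi ->
  forall k : nat, (1 <= k)%N -> kminus k = 0%N -> 0 <= dcoef phi k.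

End Operators.

(* Main.v *)
Require Import Defs.
From mathcomp Require Import all_boot all_order all_algebra.
From mathcomp Require Import zify ring.

Set Implicit Arguments.
Unset Strict Implicit.
Unset Printing Implicit Defensive.

Import Order.TTheory GRing.Theory Num.Theory.
Local Open Scope ring_scope.

(** The operators S_k are made visible by giving the positions coordinates.
A position k with label i = i_k, the m-th occurrence of i, is sent to the pair
(i, r) where r = h(i) + m - 1. Because the sequence is adapted, two occurrences
of i enclose exactly one occurrence of each neighbour j, and the heights h can
be chosen along the Dynkin diagram, which is a tree, so that this occurrence
has the same r when j > i and the coordinate r + 1 when j < i
([height_step], [between_rho]). Hence beta_k only depends on (i, r), in a way
that no longer mentions the sequence ([dcoef_beta_grid]); the sequence survives
in h alone, which decreases by 0 or 1 along each edge ([height_slope]), and the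
first occurrence of i is the one with r = h(i).

It is then enough to find, for each starting point (i0, r0), a family of forms
that contains x_(i0, r0), is closed under the operators, and whose members have
a negative coefficient at (i, r) only if (i, r - 1) is still a position, that
is, h(i) <= r - 1 ([positivity_of_stable]). In types A, B and D the families
have integral coefficients, and each S_k is a sequence of unit steps that move
the coefficient at k by one towards 0 ([stable_of_unit_steps]). They come from
the combinatorics of fundamental representations.

- Type A: columns of boxes, the coefficient at (i, r) being
  [a_r = i] - [a_(r - 1) = i + 1] for a strictly decreasing sequence a. A
  positive coefficient is a box i that may become i + 1, a negative one is a box
  i + 1 that may become i; strictness forces boxes to lie where the bound on
  r - 1 holds ([column_raise], [column_lower]).
- Type B: add the coefficients of type A_(2n-1) at the nodes i and 2n - i that
  share the same time. Both summands lie in -1, 0, 1, so opposite signs cancel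
  to a zero coefficient on which the operator is the identity; otherwise each
  nonzero summand is a legal move of the column ([fold_beta]).
- Type C: the two Cartan matrices are transposes, and rescaling x_n by 2 carries
  the operators of type B to those of type C ([weight_beta]).
- Type D, nodes up to n - 2: columns in the vector representation, whose crystal
  is a chain that forks once into two incomparable boxes ([fork_column]).
- Type D, spin nodes: strict partitions whose rows start alternately at the
  nodes n and n - 1 ([spin_raise], [spin_lower]). *)

(** * Coefficients of the forms *)

Lemma dcoef_x (j k : nat) : (0 < j)%N -> (0 < k)%N ->
  dcoef (x_ j) k = (k == j)%:R.
Proof.
case: j k => // j [|k] // _ _.
by rewrite /dcoef /x_ /= coefXn eqSS eq_sym.
Qed.

Lemma dcoefD (f g : Qdual) (k : nat) :
  dcoef (dadd f g) k = dcoef f k + dcoef g k.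
Proof. by []. Qed.

Lemma dcoefN (f : Qdual) (k : nat) : dcoef (dopp f) k = - dcoef f k.
Proof. by []. Qed.

Lemma dcoefZ (c : rat) (f : Qdual) (k : nat) :
  dcoef (dscale c f) k = c * dcoef f k.
Proof. by []. Qed.

Lemma dcoef_sum (a b : nat) (F : nat -> Qdual) (k : nat) :
  dcoef (\big[dadd/dzero]_(a <= j < b) F j) k = \sum_(a <= j < b) dcoef (F j) k.
Proof. exact: (big_morph (fun f => dcoef f k)). Qed.

Lemma sum_delta (c : nat -> rat) (a b l : nat) :
  \sum_(a <= j < b) c j * (l == j)%:R = if (a <= l < b)%N then c l else 0.
Proof.
rewrite -(@big_nat1_eq rat 0 +%R c l a b) [RHS]big_mkcond /=; apply: eq_bigr => j _.
by rewrite eq_sym; case: eqP => _; rewrite ?mulr1 ?mulr0.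
Qed.

Lemma dcoef_beta (X : cartan_type) (n : nat) (s : index_seq n) (k l : nat) :
    (0 < k)%N -> (0 < l)%N ->
  dcoef (beta X s k) l = (l == k)%:R
    + (if (k < l < kplus s k)%N then (cartan X n (s k) (s l))%:~R else 0)
    + (l == kplus s k)%:R.
Proof.
move=> k_gt0 l_gt0; rewrite /beta gtn_eqF //.
have kp_gt0: (0 < kplus s k)%N.
  by rewrite /kplus; case: ex_minnP => m /andP[km _] _; apply: leq_trans km.
rewrite !dcoefD dcoef_sum !dcoef_x //; congr (_ + _ + _).
rewrite -(sum_delta (fun j => (cartan X n (s k) (s j))%:~R)).
rewrite big_nat_cond [RHS]big_nat_cond; apply: eq_bigr => j.
by case/andP=> /andP[kj _] _; rewrite dcoefZ dcoef_x // (leq_trans _ kj).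
Qed.

(** * Counting occurrences in an adapted sequence *)

Section Occurrences.
Variables (n : nat) (s : index_seq n).

Definition before (i : 'I_n) (k : nat) : nat :=
  count (fun l => s l == i) (index_iota 1 k).

Lemma before_cat (i : 'I_n) (k l : nat) : (0 < k <= l)%N ->
  before i l = (before i k + count (fun m => s m == i) (index_iota k l))%N.
Proof.
case/andP=> k_gt0 kl; rewrite /before -count_cat /index_iota.
have -> : (l - 1 = (k - 1) + (l - k))%N by lia.
by rewrite iotaD; have -> : (1 + (k - 1) = k)%N by lia.
Qed.

Lemma beforeS (i : 'I_n) (k : nat) : (0 < k)%N ->
  before i k.+1 = (before i k + (s k == i))%N.
Proof.
by move=> k_gt0; rewrite (@before_cat _ k k.+1) ?k_gt0 //= /index_iota subSnn /= addn0.
Qed.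

Lemma leq_before (i : 'I_n) (k l : nat) : (0 < k <= l)%N ->
  (before i k <= before i l)%N.
Proof. by move=> kl; rewrite (before_cat i kl) leq_addr. Qed.

Lemma ltn_before (k l : nat) : (0 < k < l)%N ->
  (before (s k) k < before (s k) l)%N.
Proof.
case/andP=> k_gt0 kl; apply: leq_trans (leq_before _ (_ : (0 < k.+1 <= l)%N)) => //.
by rewrite beforeS // eqxx addn1.
Qed.

Lemma before_inj (k l : nat) : (0 < k)%N -> (0 < l)%N -> s k = s l ->
  before (s k) k = before (s l) l -> k = l.
Proof.
move=> k_gt0 l_gt0 skl; case: (ltngtP k l) => // [kl|lk].
  by have := @ltn_before k l; rewrite k_gt0 kl -skl => /(_ isT); lia.
by have := @ltn_before l k; rewrite l_gt0 lk skl => /(_ isT); lia.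
Qed.

Lemma before_next (i : 'I_n) (k l : nat) : (0 < k < l)%N -> s k = i ->
  (forall m, (k < m < l)%N -> s m != i) -> before i l = (before i k).+1.
Proof.
case/andP=> k_gt0 kl ski skip.
rewrite (@before_cat i k.+1 l) ?kl // beforeS // ski eqxx addn1.
rewrite (@eq_in_count _ _ pred0) ?count_pred0 ?addn0 // => m.
by rewrite mem_index_iota => /skip/negbTE.
Qed.

Lemma kplusP (k : nat) : (0 < k)%N ->
  [/\ (k < kplus s k)%N, s (kplus s k) = s k &
      before (s k) (kplus s k) = (before (s k) k).+1].
Proof.
move=> k_gt0; rewrite /kplus; case: ex_minnP => m /andP[km /eqP sm] minm.
split=> //; apply: before_next => //; first by rewrite k_gt0.
move=> l /andP[kl lm]; apply/negP => sl.
by have := minm l; rewrite kl sl => /(_ isT); rewrite leqNgt lm.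
Qed.

Lemma kminus_gt0 (k : nat) : (0 < kminus s k)%N ->
  [/\ (kminus s k < k)%N, s (kminus s k) = s k &
      before (s k) k = (before (s k) (kminus s k)).+1].
Proof.
have /orP[/eqP->//|/andP[/andP[m_gt0 mk] /eqP sm] _] :
    (kminus s k == 0)%N || (0 < kminus s k < k)%N && (s (kminus s k) == s k).
  rewrite /kminus big_nat_cond; elim/big_ind: _ => [//|u v Pu Pv|l].
    by case: (leqP u v).
  by move=> /andP[-> ->]; rewrite orbT.
split=> //; apply: before_next => //; first by rewrite m_gt0.
move=> l /andP[ml lk]; apply/negP => sl.
have : (l <= kminus s k)%N.
  by apply: (@leq_bigmax_seq _ (index_iota 1 k) _ id); rewrite ?mem_index_iota //; lia.
by rewrite leqNgt ml.
Qed.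

Lemma kminus_eq0 (k : nat) : kminus s k = 0%N -> before (s k) k = 0%N.
Proof.
move=> km0; apply/eqP; rewrite -leqn0 leqNgt -has_count; apply/hasP => -[l].
rewrite mem_index_iota => lk sl.
suff : (l <= kminus s k)%N by rewrite km0; lia.
by apply: (@leq_bigmax_seq _ (index_iota 1 k) _ id); rewrite ?mem_index_iota.
Qed.

Lemma count_alternating (T : eqType) (a b : T) (m : nat) : a != b ->
  count_mem a (mkseq (fun r => if odd r then b else a) m) = uphalf m /\
  count_mem b (mkseq (fun r => if odd r then b else a) m) = m./2.
Proof.
move=> ab; elim: m => [//|m [IHa IHb]].
rewrite mkseqS -cats1.
rewrite !count_cat {}IHa {}IHb /= uphalf_half.
case: (odd m); rewrite ?eqxx ?(negbTE ab) ?[b == a]eq_sym ?(negbTE ab) /=; lia.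
Qed.

Lemma count_subseq_upto (i j c : 'I_n) (N : nat) : (c == i) || (c == j) ->
  count_mem c (subseq_upto s i j N) = before c N.+1.
Proof.
move=> cij; rewrite /subseq_upto count_filter count_map /before.
by apply: eq_count => l /=; case: eqP => //= ->.
Qed.

(** An alternating word that starts with i has, in each prefix, either as many i
as j or one more. *)
Lemma alternates_before (i j : 'I_n) : i != j ->
    (forall N, alternates i j (subseq_upto s i j N)) ->
  forall k, (0 < k)%N -> (before j k <= before i k <= (before j k).+1)%N.
Proof.
move=> ij alt [//|N] _.
have [] := count_alternating (size (subseq_upto s i j N)) ij.
rewrite -(alt N) !count_subseq_upto ?eqxx ?orbT // => -> ->.
by rewrite uphalf_half; case: odd; lia.
Qed.

Definition first (i : 'I_n) : nat := ex_minn (ix_inf s i 0).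

Lemma firstP (i : 'I_n) :
  [/\ (0 < first i)%N, s (first i) = i & before i (first i) = 0%N].
Proof.
rewrite /first; case: ex_minnP => m /andP[m_gt0 /eqP sm] minm; split=> //.
apply/eqP; rewrite -leqn0 leqNgt -has_count; apply/hasP => -[l].
rewrite mem_index_iota => /andP[l_gt0 lm] sl.
by have := minm l; rewrite l_gt0 sl leqNgt lm => /(_ isT).
Qed.

(** For neighbours this is 0 or 1, and it records which of the two letters of the
alternating subsequence comes first. *)
Definition lead (i j : 'I_n) : nat := before j (first i).

(** Between two consecutive letters i the count of j moves by exactly one, so at
each occurrence of i the two counts differ by a constant, whose value can be
read off at the first occurrence. *)
Lemma interlacing (i j : 'I_n) : i != j ->
    (forall k, (0 < k)%N -> (before j k <= before i k <= (before j k).+1)%N) ->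
  [/\ lead i j = 0%N, lead j i = 1%N,
      forall k, (0 < k)%N -> s k = i -> before j k = before i k &
      forall k, (0 < k)%N -> s k = j -> before i k = (before j k).+1].
Proof.
move=> ij H.
have Hi k : (0 < k)%N -> s k = i -> before j k = before i k.
  move=> k_gt0 sk; have := H k k_gt0; have := H k.+1 isT.
  rewrite !beforeS // sk eqxx (negbTE ij); lia.
have Hj k : (0 < k)%N -> s k = j -> before i k = (before j k).+1.
  move=> k_gt0 sk; have := H k k_gt0; have := H k.+1 isT.
  rewrite !beforeS // sk eqxx eq_sym (negbTE ij); lia.
have [fi_gt0 fi bi] := firstP i; have [fj_gt0 fj bj] := firstP j.
by split=> //; [rewrite /lead Hi | rewrite /lead Hj // bj].
Qed.

Lemma adapted_interlacing (X : cartan_type) (i j : 'I_n) :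
    adapted X s -> i != j -> cartan X n i j != 0 ->
  (lead i j + lead j i = 1)%N /\
  (forall k, (0 < k)%N -> s k = i -> before j k = (before i k + lead i j)%N).
Proof.
move=> ad ij cij; have ji : j != i by rewrite eq_sym.
case: (ad i j ij cij) => [alt|alt].
  have [-> -> Hi _] := interlacing ij (alternates_before ij alt).
  by split=> // k k_gt0 sk; rewrite addn0 Hi.
have alt' N : alternates j i (subseq_upto s j i N).
  have -> : subseq_upto s j i N = subseq_upto s i j N by apply: eq_filter => c; rewrite orbC.
  exact: alt.
have [-> -> _ Hj] := interlacing ji (alternates_before ji alt').
by split=> // k k_gt0 sk; rewrite addn1 Hj.
Qed.

(** Both inequalities are comparisons of counts of the letter i_l: position l lies
after position p exactly when the count before l is at least the count before
p, and the count before an occurrence of i_k is known by interlacing. *)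
Lemma between_before (X : cartan_type) (k l : nat) :
    adapted X s -> (0 < k)%N -> (0 < l)%N -> s k != s l ->
    cartan X n (s k) (s l) != 0 ->
  (k < l < kplus s k)%N =
  (before (s l) l == before (s k) k + lead (s k) (s l))%N.
Proof.
move=> ad k_gt0 l_gt0 kl ckl.
have [_ cnt] := adapted_interlacing ad kl ckl.
have [kkp skp bkp] := kplusP k_gt0.
have split_at m : (0 < m)%N -> s m = s k ->
    (m < l)%N = (before (s l) m <= before (s l) l)%N.
  move=> m_gt0 sm; apply/idP/idP => [ml|].
    by apply: leq_before; rewrite m_gt0 ltnW.
  apply: contraLR; rewrite -leqNgt -ltnNge leq_eqVlt => /orP[/eqP lm|lm].
    by rewrite lm sm eqxx in kl.
  by apply: ltn_before; rewrite l_gt0.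
have kp_gt0 : (0 < kplus s k)%N by apply: leq_trans kkp.
have neq_kp : l != kplus s k by apply: contraNneq kl => ->; rewrite skp.
rewrite (split_at k) // cnt //.
have -> : (l < kplus s k)%N = ~~ (kplus s k < l)%N.
  by rewrite -leqNgt [RHS]leq_eqVlt (negbTE neq_kp).  
by rewrite (split_at (kplus s k)) // (cnt (kplus s k)) // bkp; lia.
Qed.

End Occurrences.

(** * Coordinates of the positions *)

(** The form beta at the grid point (i, r), evaluated at the grid point (j, u).
The shift by 1 for j < i is the choice of origin of the coordinate of j. *)
Definition grid_beta (X : cartan_type) (n i : nat) (r : int) (j : nat) (u : int)
    : int :=
  if i == j then (u == r)%:Z + (u == r + 1)%:Z
  else cartan_entry X n i j * (u == r + (j < i)%N%:Z)%:Z.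

Definition slope (X : cartan_type) (n : nat) (h : nat -> int) : Prop :=
  forall i j : nat, (0 < i < j)%N -> (j <= n)%N -> cartan_entry X n i j != 0 ->
  h j <= h i <= h j + 1.

Section Coordinates.
Variables (X : cartan_type) (n : nat) (s : index_seq n).
Hypothesis ad : adapted X s.
Hypothesis hn : valid_rank X n.

Definition label (k : nat) : nat := (s k).+1.

Lemma label_bound (k : nat) : (0 < label k <= n)%N.
Proof. exact: ltn_ord. Qed.

Definition index_of (i : nat) : 'I_n := insubd (s 1%N) i.-1.

Lemma index_of_label (k : nat) : index_of (label k) = s k.
Proof. exact: valKd. Qed.

Lemma val_index_of (i : nat) : (0 < i <= n)%N -> (index_of i).+1 = i.
Proof. by case: i => // i /= lt_i; rewrite /index_of insubdK. Qed.

(** Along the path 1, ..., n the height drops by one exactly when the next label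
occurs first; this makes the (i + 1) enclosed between two i share the coordinate
of the earlier one. *)
Definition chain_height (i : nat) : int :=
  - (\sum_(1 <= m < i) lead s (index_of m) (index_of m.+1))%N%:Z.

Definition height (i : nat) : int :=
  match X with
  | TypeD =>
      if i == n then
        chain_height n.-2 - (lead s (index_of n.-2) (index_of n))%:Z
      else chain_height i
  | _ => chain_height i
  end.

Lemma chain_heightS (i : nat) : (0 < i)%N ->
  chain_height i.+1 = chain_height i - (lead s (index_of i) (index_of i.+1))%:Z.
Proof. by move=> i_gt0; rewrite /chain_height big_nat_recr //=; lia. Qed.

(** The edges of the diagram, oriented upwards: each label j > 1 has one smaller
neighbour, so that the heights can be defined by recursion. *)
Lemma neighbours (i j : nat) :
    (0 < i < j)%N -> (j <= n)%N -> cartan_entry X n i j != 0 ->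
  if X is TypeD then (j == i.+1) && (j != n) || (j == n) && (i == n.-2)
  else j == i.+1.
Proof.
move: hn; case: X => /= n_big ij jn; rewrite /cartanA /adjacent;
  do ![case: ifP => //]; lia.
Qed.

Lemma height_step (i j : nat) :
    (0 < i < j)%N -> (j <= n)%N -> cartan_entry X n i j != 0 ->
  height j = height i - (lead s (index_of i) (index_of j))%:Z.
Proof.
move=> ij jn c_ij; have := neighbours ij jn c_ij; move: hn; rewrite /height.
have i_gt0 : (0 < i)%N by case/andP: ij.
case: X => /= n_big; do ?by move/eqP->; exact: chain_heightS.
case/orP=> [/andP[/eqP j_eq jNn]|/andP[/eqP-> /eqP->]].
  have -> : (i == n) = false by lia.
  by rewrite (negbTE jNn) j_eq chain_heightS.
have -> : (n.-2 == n) = false by lia.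
by rewrite eqxx.
Qed.

Lemma cartanE (i j : nat) : (0 < i <= n)%N -> (0 < j <= n)%N ->
  cartan X n (index_of i) (index_of j) = cartan_entry X n i j.
Proof. by move=> Hi Hj; rewrite mxE !val_index_of. Qed.

Lemma index_of_neq (i j : nat) : (0 < i <= n)%N -> (0 < j <= n)%N ->
  i != j -> index_of i != index_of j.
Proof.
move=> Hi Hj; apply: contraNneq => /(congr1 (fun o : 'I_n => o.+1)).
by rewrite !val_index_of // => ->.
Qed.

Lemma cartan_entry_sym0 (i j : nat) : (0 < i <= n)%N -> (0 < j <= n)%N ->
  cartan_entry X n i j != 0 -> cartan_entry X n j i != 0.
Proof.
move: hn; case: X => /= n_big Hi Hj; rewrite /cartanA /adjacent;
  do ![case: ifP => //]; lia.
Qed.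

Lemma height_slope : slope X n height.
Proof.
move=> i j ij jn c_ij; rewrite (height_step ij jn c_ij).
have Hi : (0 < i <= n)%N by lia. have Hj : (0 < j <= n)%N by lia.
have neq_ij : i != j by lia.
have [] := adapted_interlacing ad (index_of_neq Hi Hj neq_ij).
  by rewrite cartanE.
lia.
Qed.

Definition rho (k : nat) : int := height (label k) + (before s (s k) k)%:Z.

Lemma height_leq_rho (k : nat) : height (label k) <= rho k.
Proof. by rewrite /rho lerDl. Qed.

Lemma grid_inj (k l : nat) : (0 < k)%N -> (0 < l)%N -> s k = s l ->
  (rho l == rho k) = (l == k).
Proof.
move=> k_gt0 l_gt0 skl; apply/eqP/eqP => [|->//]; rewrite /rho /label skl => r_eq.
apply: (@before_inj _ s) => //; have := r_eq; rewrite -skl; lia.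
Qed.

Lemma rho_kplus (k : nat) : (0 < k)%N -> rho (kplus s k) = rho k + 1.
Proof.
by case/(kplusP s)=> _ skp bkp; rewrite /rho /label skp bkp; lia.
Qed.

(** The heights are chosen for this equivalence: the constant in
[between_before] is absorbed by the difference of the two heights. *)
Lemma between_rho (k l : nat) : (0 < k)%N -> (0 < l)%N -> s k != s l ->
    cartan X n (s k) (s l) != 0 ->
  (k < l < kplus s k)%N = (rho l == rho k + (label l < label k)%N%:Z).
Proof.
move=> k_gt0 l_gt0 kl c_kl; rewrite (between_before ad) //.
have [sum1 _] := adapted_interlacing ad kl c_kl.
have c_kl' : cartan_entry X n (label k) (label l) != 0.
  by have := c_kl; rewrite mxE.
have [Hk Hl] := (label_bound k, label_bound l).
rewrite /rho; case: (ltngtP (label k) (label l)) => [lt|lt|eq_l].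
- rewrite (@height_step (label k) (label l)) ?index_of_label //; lia.
- rewrite (@height_step (label l) (label k)) ?index_of_label //;
    by [lia | exact: cartan_entry_sym0].
by case/eqP: kl; apply: val_inj; case: eq_l.
Qed.

Lemma dcoef_beta_grid (k l : nat) : (0 < k)%N -> (0 < l)%N ->
  dcoef (beta X s k) l = (grid_beta X n (label k) (rho k) (label l) (rho l))%:~R.
Proof.
move=> k_gt0 l_gt0; rewrite dcoef_beta // /grid_beta eqSS val_eqE.
have [kkp skp bkp] := kplusP s k_gt0; have kp_gt0 := leq_ltn_trans (leq0n k) kkp.
case: (s k =P s l) => [skl|/eqP kl].
  have -> : (k < l < kplus s k)%N = false.
    apply/negP => /andP[kl lkp].
    have := @ltn_before _ s k l; have := @ltn_before _ s l (kplus s k).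
    by rewrite k_gt0 l_gt0 kl lkp -skl bkp => /(_ isT) ? /(_ isT); lia.
  by rewrite -rho_kplus // !grid_inj ?skp // addr0 intrD.
have /negbTE-> : l != k by apply: contraNneq kl => ->.
have /negbTE-> : l != kplus s k by apply: contraNneq kl => ->; rewrite skp.
rewrite add0r addr0; have [c0|cN0] := eqVneq (cartan X n (s k) (s l)) 0.
  by rewrite c0 if_same; move: c0; rewrite mxE /label => ->; rewrite mul0r.
by rewrite between_rho // mxE; case: eqP; rewrite ?mulr1 ?mulr0.
Qed.

End Coordinates.

(** * Stable families of forms *)

Definition subtracts (X : cartan_type) (n : nat) (c : rat) (i : nat) (r : int)
    (f f' : nat -> int -> rat) : Prop :=
  forall j u, (0 < j <= n)%N -> f' j u = f j u - c * (grid_beta X n i r j u)%:~R.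

(** Closure is required for each f' with the right values on the labels 1, ..., n,
so values at other labels are immaterial. The bound on h i
says that the grid point (i, r - 1) is a position. *)
Definition stable (X : cartan_type) (n : nat) (h : nat -> int)
    (P : (nat -> int -> rat) -> Prop) : Prop :=
  forall f, P f -> forall i r, (0 < i <= n)%N ->
    (0 < f i r -> forall f', subtracts X n (f i r) i r f f' -> P f') /\
    (f i r < 0 ->
       h i <= r - 1 /\ forall f', subtracts X n (f i r) i (r - 1) f f' -> P f').

Definition coordinate (n : nat) (i0 : nat) (r0 : int) (f : nat -> int -> rat) :=
  forall j u, (0 < j <= n)%N -> f j u = ((j == i0) && (u == r0))%:R.

Definition stable_start (X : cartan_type) (n : nat) (h : nat -> int) (i0 : nat)
    (r0 : int) : Prop :=
  exists P, stable X n h P /\ forall f, coordinate n i0 r0 f -> P f.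

(** At a first occurrence (i, r) one has r = h i, so the bound contained in
[stable] excludes a negative coefficient there. It also shows that kminus is
nonzero whenever S_k subtracts a nonzero multiple of beta at kminus k, which
then sits at (i, r - 1). *)
Lemma positivity_of_stable (X : cartan_type) (n : nat) (s : index_seq n) :
    valid_rank X n -> adapted X s ->
    (forall i0 r0, (0 < i0 <= n)%N -> height X s i0 <= r0 ->
       stable_start X n (height X s) i0 r0) ->
  positivity_condition X s.
Proof.
move=> hn ad starts phi [j0 [js [j0_gt0 js_gt0 ->]]].
have [P [P_stable P_start]] :=
  starts _ _ (label_bound s j0) (height_leq_rho X s j0).
pose represents (psi : Qdual) f :=
  forall k, (0 < k)%N -> dcoef psi k = f (label s k) (rho X s k).
have kminusP k : (0 < k)%N -> height X s (label s k) <= rho X s k - 1 ->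
    [/\ (0 < kminus s k)%N, label s (kminus s k) = label s k &
        rho X s (kminus s k) = rho X s k - 1].
  move=> k_gt0 low; case: (posnP (kminus s k)) => [/kminus_eq0 b0|km_gt0].
    by move: low; rewrite /rho b0; lia.
  have [_ skm bkm] := kminus_gt0 km_gt0; rewrite /label skm; split=> //.
  by rewrite /rho /label skm bkm; lia.
have : exists2 f, P f & represents (foldl (fun psi j => S_ X s j psi) (x_ j0) js) f.
  have : exists2 f, P f & represents (x_ j0) f.
    exists (fun j u => ((j == label s j0) && (u == rho X s j0))%:R).
      by apply: P_start => j u _.
    move=> k k_gt0; rewrite dcoef_x // eqSS val_eqE.
    case: (s k =P s j0) => [skj|skj] /=; first by rewrite grid_inj.
    by case: eqP => // kj; case: skj; rewrite kj.
  elim: js (x_ j0) js_gt0 => [//|k js IH] psi /= /andP[k_gt0 js_gt0] [f Pf f_psi].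
  apply: IH js_gt0 _; rewrite /S_.
  have [up down] := P_stable f Pf _ (rho X s k) (label_bound s k).
  rewrite f_psi // in up down *.
  pose f' r := fun j u => f j u - f (label s k) (rho X s k) *
    (grid_beta X n (label s k) r j u)%:~R.
  case: (ltgtP 0 (f (label s k) (rho X s k))) => [c_gt0|c_lt0|c_eq0].
  - exists (f' (rho X s k)); first by apply: (up c_gt0) => j u _.
    by move=> l l_gt0; rewrite dcoefD dcoefN dcoefZ f_psi // dcoef_beta_grid.
  - have [low {}down] := down c_lt0; have [km_gt0 lab_km rho_km] := kminusP k k_gt0 low.
    exists (f' (rho X s k - 1)); first by apply: down => j u _.
    move=> l l_gt0; rewrite dcoefD dcoefN dcoefZ f_psi // dcoef_beta_grid //.
    by rewrite lab_km rho_km.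
  exists f => // l l_gt0; rewrite dcoefD dcoefN dcoefZ f_psi //.
  by rewrite -c_eq0 mul0r subr0.
case=> f Pf f_phi k k_gt0 km0; rewrite f_phi // leNgt; apply/negP => f_lt0.
have [_ /(_ f_lt0)[low _]] := P_stable f Pf _ (rho X s k) (label_bound s k).
by have [] := kminusP k k_gt0 low; rewrite km0.
Qed.

(** A step by the whole coefficient is an iteration of unit steps, since beta at
(i, r) has coefficient 1 at (i, r) and at (i, r + 1). *)
Section UnitSteps.
Variables (X : cartan_type) (n : nat) (h : nat -> int).
Variables (T : Type) (inv : T -> Prop) (F : T -> nat -> int -> int).

Hypothesis raise : forall a i r, inv a -> (0 < i <= n)%N -> 0 < F a i r ->
  exists2 a', inv a' &
    forall j u, (0 < j <= n)%N -> F a' j u = F a j u - grid_beta X n i r j u.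

Hypothesis lower : forall a i r, inv a -> (0 < i <= n)%N -> F a i r < 0 ->
  h i <= r - 1 /\ exists2 a', inv a' &
    forall j u, (0 < j <= n)%N ->
      F a' j u = F a j u + grid_beta X n i (r - 1) j u.

Lemma raise_iter (m : nat) a i r : inv a -> (0 < i <= n)%N -> F a i r = m%:Z ->
  exists2 a', inv a' & forall j u, (0 < j <= n)%N ->
    F a' j u = F a j u - m%:Z * grid_beta X n i r j u.
Proof.
elim: m a => [|m IH] a Ia Hi Fa.
  by exists a => // j u _; rewrite mul0r subr0.
have [|b Ib Fb] := raise (r := r) Ia Hi; first by rewrite Fa.
have [|b' Ib' Fb'] := IH b Ib Hi.
  by rewrite Fb // Fa /grid_beta eqxx; lia.
by exists b' => // j u Hj; rewrite Fb' // Fb // -addn1 PoszD; ring.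
Qed.

Lemma lower_iter (m : nat) a i r : inv a -> (0 < i <= n)%N -> F a i r = - m%:Z ->
  exists2 a', inv a' & forall j u, (0 < j <= n)%N ->
    F a' j u = F a j u + m%:Z * grid_beta X n i (r - 1) j u.
Proof.
elim: m a => [|m IH] a Ia Hi Fa.
  by exists a => // j u _; rewrite mul0r addr0.
have [|_ [b Ib Fb]] := lower (r := r) Ia Hi; first by rewrite Fa.
have [|b' Ib' Fb'] := IH b Ib Hi.
  by rewrite Fb // Fa /grid_beta eqxx; lia.
by exists b' => // j u Hj; rewrite Fb' // Fb // -addn1 PoszD; ring.
Qed.

Lemma stable_of_unit_steps : stable X n h
  (fun f => exists2 a, inv a & forall j u, (0 < j <= n)%N -> f j u = (F a j u)%:~R).
Proof.
move=> f [a Ia fa] i r Hi; rewrite fa //; split=> [|].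
  rewrite ltr0z => F_gt0 f' sub; have [|a' Ia' Fa'] := @raise_iter `|F a i r| a i r Ia Hi.
    by rewrite gtz0_abs.
  exists a' => // j u Hj; rewrite sub // fa // Fa' // gtz0_abs //.
  by rewrite rmorphB rmorphM.
rewrite ltrz0 => F_lt0; have [hi _] := lower Ia Hi F_lt0; split=> // f' sub.
have [|a' Ia' Fa'] := @lower_iter `|F a i r| a i r Ia Hi.
  by rewrite ltz0_abs // opprK.
exists a' => // j u Hj; rewrite sub // fa // Fa' // ltz0_abs //.
by rewrite mulNr rmorphB rmorphM.
Qed.

End UnitSteps.

(** * Columns of boxes and type A *)

Definition change (a : int -> int) (r v : int) : int -> int :=
  fun u => if u == r then v else a u.

(** A box with value v contributes +1 at its own place, and a box with value w at
the preceding place contributes -1: an arrow v -> w of the crystal can be applied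
to the former and undone on the latter. *)
Definition gap (a : int -> int) (v w : int) (r : int) : int :=
  (a r == v)%:Z - (a (r - 1) == w)%:Z.

(** The loss of the gap of v and w at u when the box at r passes from v0 to v1. *)
Definition jump (v0 v1 r v w u : int) : int :=
  ((u == r) && (v0 == v))%:Z - ((u == r) && (v1 == v))%:Z
  - ((u == r + 1) && (v0 == w))%:Z + ((u == r + 1) && (v1 == w))%:Z.

Lemma jumpC (v0 v1 r v w u : int) : jump v1 v0 r v w u = - jump v0 v1 r v w u.
Proof. by rewrite /jump; ring. Qed.

Lemma gap_change (a : int -> int) (r v0 v1 v w u : int) : a r = v0 ->
  gap (change a r v1) v w u = gap a v w u - jump v0 v1 r v w u.
Proof.
rewrite /gap /change /jump => <-; have -> : (u - 1 == r) = (u == r + 1) by lia.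
case: (u =P r) => [->|_]; case: (_ =P r + 1) => [E|_]; try lia.
by rewrite E addrK; lia.
Qed.

(** The entries beyond L for r < r0 stand for the region above the column; no
arrow leaves or reaches them. The lower bound on the entries for r >= r0 is that
of the column with entries N, N - 1, ..., 1, continued by nonpositive values to
which no arrow applies. *)
Definition column (L N : nat) (r0 : int) (a : int -> int) : Prop :=
  (forall r, r < r0 -> L%:Z < a r) /\
  (forall r, r0 <= r -> a (r + 1) < a r /\ N%:Z + r0 - r <= a r).

(** The form beta for the infinite path, with all integers as nodes. *)
Definition chain_beta (e r j u : int) : int := jump e (e + 1) r j (j + 1) u.

(* The identities below are sums of indicators; each is decided from those
   already known before a case distinction is made on it. *)
Ltac decide_bool b :=
  first [ have -> : b = false by lia | have -> : b = true by lia
        | case: (boolP b) => ? ].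

Ltac decide_atoms := rewrite ?eqxx /=; repeat
  (match goal with
  | |- context [@eq_op ?T ?x ?y] => decide_bool (@eq_op T x y)
  | |- context [leq ?x ?y] => decide_bool (leq x y)
  end; rewrite ?andbT ?andbF /=); try lia.

Section Column.
Variables (L N : nat) (r0 : int).

(** A positive coefficient says that the box at r is e and that its predecessor,
larger than e, is not e + 1; so raising the box keeps the column strict. *)
Lemma column_raise (a : int -> int) (e r : int) :
    column L N r0 a -> e < L%:Z -> 0 < gap a e (e + 1) r ->
  exists2 a', column L N r0 a' & forall j u,
    gap a' j (j + 1) u = gap a j (j + 1) u - chain_beta e r j u.
Proof.
move=> [big dec] eL; rewrite {1}/gap => g_gt0.
have ar : a r = e by lia. have ar1 : a (r - 1) != e + 1 by lia.
have r0r : r0 <= r by case: (lerP r0 r) => // /big; lia.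
exists (change a r (e + 1)); last first.
  by move=> j u; apply: gap_change.
split=> u; rewrite /change.
  by move=> ur; have -> : (u == r) = false by [lia]; exact: big.
move=> r0u; have [dec1 low] := dec u r0u.
case: eqP => [u1r|_]; case: eqP => [ur|_]; try lia; last by rewrite -ur in ar; split; lia.
have ur1 : u = r - 1 by lia.
by rewrite ur1 in dec1 low *; rewrite subrK in dec1; split; lia.
Qed.

(** A negative coefficient says that the box at r - 1 is e + 1 while the next one,
smaller than e + 1, is not e. The next box is then at most e - 1, and its lower
bound yields the bound on r - 1. *)
Lemma column_lower (a : int -> int) (e r : int) :
    column L N r0 a -> e < L%:Z -> gap a e (e + 1) r < 0 ->
  [/\ r0 <= r - 1, N%:Z + r0 - e <= r - 1 &
  exists2 a', column L N r0 a' & forall j u,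
    gap a' j (j + 1) u = gap a j (j + 1) u + chain_beta e (r - 1) j u].
Proof.
move=> [big dec] eL; rewrite {1}/gap => g_lt0.
have ar : a r != e by lia. have ar1 : a (r - 1) = e + 1 by lia.
have r0r : r0 <= r - 1 by case: (lerP r0 (r - 1)) => // /big; lia.
have [dec_r _] := dec _ r0r; rewrite subrK in dec_r.
have [_ low_r] := dec r ltac:(lia).
split=> //; first by lia.
exists (change a (r - 1) e); last first.
  by move=> j u; rewrite (gap_change _ _ _ _ ar1) jumpC opprK.
split=> u; rewrite /change.
  by move=> ur; have -> : (u == r - 1) = false by [lia]; exact: big.
move=> r0u; have [dec1 low] := dec u r0u.
case: eqP => [u1r|_]; case: eqP => [ur|_]; try lia.
- by rewrite u1r in dec1; split; lia.
by rewrite ur subrK; split; lia.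
Qed.

Definition top_column : int -> int :=
  fun r => if r < r0 then L.+1%:Z else N%:Z + r0 - r.

Lemma top_columnP : column L N r0 top_column.
Proof. by split=> r rr; rewrite /top_column; do ?case: ifP; lia. Qed.

Lemma gap_top (e r : int) : (N <= L)%N -> e < L%:Z ->
  gap top_column e (e + 1) r = ((e == N%:Z) && (r == r0))%:Z.
Proof. by move=> NL eL; rewrite /gap /top_column; do ?case: ifP; lia. Qed.

End Column.

Section Slope.
Variables (X : cartan_type) (n : nat) (h : nat -> int).
Hypothesis h_slope : slope X n h.

Lemma slope_chain (m i j : nat) : (m <= n)%N ->
    (forall k, (0 < k < m)%N -> cartan_entry X n k k.+1 != 0) ->
  (0 < i <= j)%N -> (j <= m)%N -> h j <= h i <= h j + (j%:Z - i%:Z).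
Proof.
move=> mn links; elim: j => [|j IH] ij jm; first by lia.
have [->|ij'] := eqVneq i j.+1; first by lia.
have := @h_slope j j.+1; have := links j; have := IH.
by move=> /(_ ltac:(lia) ltac:(lia)) ? /(_ ltac:(lia)) c /(_ ltac:(lia) ltac:(lia) c); lia.
Qed.

End Slope.

Section TypeA.
Variables (n : nat) (h : nat -> int) (N : nat) (r0 : int).
Hypothesis h_slope : slope TypeA n h.
Hypothesis N_bound : (0 < N <= n)%N.
Hypothesis h_r0 : h N <= r0.

Lemma grid_betaA (i j : nat) (r u : int) :
  grid_beta TypeA n i r j u = chain_beta i r j u.
Proof.
rewrite /grid_beta /chain_beta /jump /= /cartanA /adjacent.
by decide_atoms.
Qed.

Lemma stable_typeA : stable_start TypeA n h N r0.
Proof.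
have h_chain i j : (0 < i <= j)%N -> (j <= n)%N -> h j <= h i <= h j + (j%:Z - i%:Z).
  apply: (slope_chain h_slope (leqnn n)) => k kn /=.
  by rewrite /cartanA /adjacent; do ?case: ifP; lia.
exists (fun f => exists2 a, column n.+1 N r0 a &
  forall j u, (0 < j <= n)%N -> f j u = (gap a j (j%:Z + 1) u)%:~R); split.
  apply: (stable_of_unit_steps (F := fun a i r => gap a i (i%:Z + 1) r)).
    move=> a i r col Hi g_gt0.
    have [|a' col' Ea'] := column_raise col _ g_gt0; first by lia.
    by exists a' => // j u _; rewrite grid_betaA.
  move=> a i r col Hi g_lt0.
  have [|r1 r2 [a' col' Ea']] := column_lower col _ g_lt0; first by lia.
  split; last by exists a' => // j u _; rewrite grid_betaA.
  by case: (leqP i N) => iN; [have := h_chain i N | have := h_chain N i]; lia.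
move=> f f0; exists (top_column n.+1 N r0); first exact: top_columnP.
by move=> j u Hj; rewrite f0 // gap_top // ?eqz_nat; lia.
Qed.

End TypeA.

(** * Types B and C *)

Section TypeB.
Variables (n : nat) (h : nat -> int) (N : nat) (r0 : int).
Hypothesis n_big : (2 <= n)%N.
Hypothesis h_slope : slope TypeB n h.
Hypothesis N_bound : (0 < N <= n)%N.
Hypothesis h_r0 : h N <= r0.

(** Node 2n - i of the path 1, ..., 2n - 1. In the path, the points (i, r) with the
same 2r + i are simultaneous; the shift by i - n of the coordinate makes the
mirror image of (i, r) simultaneous with it. *)
Definition mirror (G : int -> int -> int) (i : nat) (r : int) : int :=
  if (i < n)%N then G (2 * n%:Z - i%:Z) (r + i%:Z - n%:Z) else 0.

Definition fold (G : int -> int -> int) (i : nat) (r : int) : int :=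
  G i%:Z r + mirror G i r.

(** Folding the path at node n doubles the coefficient of node n - 1 in beta at
node n and preserves all others: this is the Cartan matrix of type B. *)
Lemma fold_beta (i j : nat) (r u : int) : (0 < i <= n)%N -> (0 < j <= n)%N ->
  fold (chain_beta i r) j u = grid_beta TypeB n i r j u.
Proof.
rewrite /fold /mirror /grid_beta /chain_beta /jump /= /cartanA /adjacent => Hi Hj.
by clear h_slope N_bound h_r0; decide_atoms.
Qed.

Lemma fold_beta_mirror (i j : nat) (r u : int) : (0 < i < n)%N -> (0 < j <= n)%N ->
  fold (chain_beta (2 * n%:Z - i%:Z) (r + i%:Z - n%:Z)) j u
  = grid_beta TypeB n i r j u.
Proof.
rewrite /fold /mirror /grid_beta /chain_beta /jump /= /cartanA /adjacent => Hi Hj.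
by clear h_slope N_bound h_r0; decide_atoms.
Qed.

Definition fold_coef (a : int -> int) : nat -> int -> int :=
  fold (fun e r => gap a e (e + 1) r).

Lemma foldD (G1 G2 : int -> int -> int) (i : nat) (r : int) :
  fold (fun e u => G1 e u + G2 e u) i r = fold G1 i r + fold G2 i r.
Proof. by rewrite /fold /mirror; case: ifP => _; rewrite ?addr0 // addrACA. Qed.

Lemma foldN (G : int -> int -> int) (i : nat) (r : int) :
  fold (fun e u => - G e u) i r = - fold G i r.
Proof. by rewrite /fold /mirror; case: ifP => _; rewrite ?addr0 // opprD. Qed.

Lemma eq_fold (G1 G2 : int -> int -> int) (i : nat) (r : int) :
  (forall e u, G1 e u = G2 e u) -> fold G1 i r = fold G2 i r.
Proof. by move=> eqG; rewrite /fold /mirror !eqG. Qed.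

(** If the folded coefficient is positive then one of its two summands is, and that
summand is a move of the column of type A; the same holds for negative
coefficients. *)
Lemma stable_typeB : stable_start TypeB n h N r0.
Proof.
have h_chain i j : (0 < i <= j)%N -> (j <= n)%N -> h j <= h i <= h j + (j%:Z - i%:Z).
  apply: (slope_chain h_slope (leqnn n)) => k kn /=.
  by rewrite /cartanA /adjacent; do ?case: ifP; lia.
have h_low i : (0 < i <= n)%N -> h i <= r0 + (n%:Z - i%:Z) /\
    (forall r, r0 <= r -> N%:Z + r0 - i%:Z <= r -> h i <= r).
  move=> Hi; case: (leqP i N) => iN; [have := h_chain i N | have := h_chain N i].
    by move=> /(_ ltac:(lia) ltac:(lia)) ?; split=> [|r]; lia.
  by move=> /(_ ltac:(lia) ltac:(lia)) ?; split=> [|r]; lia.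
exists (fun f => exists2 a, column (2 * n) N r0 a &
  forall j u, (0 < j <= n)%N -> f j u = (fold_coef a j u)%:~R); split.
  apply: (stable_of_unit_steps (F := fold_coef)).
    move=> a i r col Hi F_gt0.
    have /orP[g_gt0|m_gt0] : (0 < gap a i (i%:Z + 1) r) ||
        (0 < mirror (fun e u => gap a e (e + 1) u) i r).
      by move: F_gt0; rewrite /fold_coef /fold; lia.
      have [|a' col' Ea'] := column_raise col _ g_gt0; first by lia.
      exists a' => // j u Hj; rewrite -fold_beta // -foldN -foldD.
      exact: eq_fold.
    move: m_gt0; rewrite /mirror; case: ifP => // lt_in g_gt0.
    have [|a' col' Ea'] := column_raise col _ g_gt0; first by lia.
    exists a' => // j u Hj; rewrite -fold_beta_mirror; [|lia|lia].
    by rewrite -foldN -foldD; exact: eq_fold.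
  move=> a i r col Hi F_lt0; have [low1 low2] := h_low i Hi.
  have /orP[g_lt0|m_lt0] : (gap a i (i%:Z + 1) r < 0) ||
      (mirror (fun e u => gap a e (e + 1) u) i r < 0).
    by move: F_lt0; rewrite /fold_coef /fold; lia.
    have [|r1 r2 [a' col' Ea']] := column_lower col _ g_lt0; first by lia.
    split; first exact: low2.
    exists a' => // j u Hj; rewrite -fold_beta // -foldD.
    exact: eq_fold.
  move: m_lt0; rewrite /mirror; case: ifP => // lt_in g_lt0.
  have [|r1 _ [a' col' Ea']] := column_lower col _ g_lt0; first by lia.
  split; first by lia.
  exists a' => // j u Hj; rewrite -fold_beta_mirror; [|lia|lia].
  rewrite -foldD; apply: eq_fold => e v; rewrite Ea'; congr (_ + chain_beta _ _ _ _); lia.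
move=> f f0; exists (top_column (2 * n) N r0); first exact: top_columnP.
move=> j u Hj; rewrite f0 // /fold_coef /fold gap_top /mirror ?eqz_nat; [|lia|lia].
case: ifP => lt_jn; last by rewrite addr0.
rewrite gap_top; [|lia|lia].
by have -> : (2 * n%:Z - j%:Z == N%:Z) = false by [lia]; rewrite addr0.
Qed.

End TypeB.

Section TypeC.
Variables (n : nat) (h : nat -> int) (N : nat) (r0 : int).
Hypothesis n_big : (2 <= n)%N.
Hypothesis h_slope : slope TypeC n h.
Hypothesis N_bound : (0 < N <= n)%N.
Hypothesis h_r0 : h N <= r0.

(** The factors that symmetrize the two Cartan matrices. *)
Definition weight (i : nat) : rat := if i == n then 2 else 1.

Lemma weight_gt0 (i : nat) : 0 < weight i.
Proof. by rewrite /weight; case: ifP. Qed.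

Lemma weight_beta (i j : nat) (r u : int) : (0 < i <= n)%N -> (0 < j <= n)%N ->
  weight i * (grid_beta TypeC n i r j u)%:~R
  = weight j * (grid_beta TypeB n i r j u)%:~R.
Proof.
rewrite /grid_beta; case: (eqVneq i j) => [-> //|neq_ij].
rewrite !intrM !mulrA => Hi Hj; congr (_ * _).
rewrite /weight /cartan_entry /cartanA /adjacent.
by do ![case: ifP] => //; lia.
Qed.

Lemma slope_typeB : slope TypeB n h.
Proof.
move=> i j ij jn c_ij; apply: h_slope => //; move: c_ij.
by rewrite /= /cartanA /adjacent; do ?case: ifP; lia.
Qed.

(** The operators commute with multiplication by positive constants. So a form is
rescaled to weight 1 at the starting node N, and the start x_n of type C becomes
the start x_n of type B. *)
Lemma stable_typeC : stable_start TypeC n h N r0.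
Proof.
have [P [P_stable P_start]] := stable_typeB n_big slope_typeB N_bound h_r0.
have w0 i : weight i != 0 by rewrite gt_eqF ?weight_gt0.
pose q i := weight N / weight i.
have q_gt0 i : 0 < q i by rewrite divr_gt0 ?weight_gt0.
exists (fun f => P (fun j u => q j * f j u)); split.
  have step f i r f' c : (0 < i <= n)%N -> subtracts TypeC n c i r f f' ->
      subtracts TypeB n (q i * c) i r (fun j u => q j * f j u) (fun j u => q j * f' j u).
    move=> Hi sub j u Hj; rewrite sub // mulrBr; congr (_ - _).
    have -> : (grid_beta TypeC n i r j u)%:~R =
        weight j * (grid_beta TypeB n i r j u)%:~R / weight i :> rat.
      by rewrite -weight_beta // mulrAC mulfV // mul1r.
    by rewrite /q; field; rewrite !w0.
  move=> f Pf i r Hi; have [up down] := P_stable _ Pf i r Hi.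
  split=> [f_gt0 f' sub|f_lt0].
    by apply: up; [rewrite mulr_gt0 | exact: step].
  have [|low {}down] := down; first by rewrite pmulr_rlt0.
  by split=> // f' sub; apply: down; exact: step.
move=> f f0; apply: P_start => j u Hj; rewrite f0 //.
by case: eqP => [->|_]; rewrite ?mulr0 // /q mulfV // mul1r.
Qed.

End TypeC.

(** * Type D: the vector representation *)

Section TypeD.
Variables (n : nat) (h : nat -> int) (N : nat) (r0 : int).
Hypothesis n_big : (4 <= n)%N.
Hypothesis h_slope : slope TypeD n h.

Lemma slope_chainD (i j : nat) : (0 < i <= j)%N -> (j < n)%N ->
  h j <= h i <= h j + (j%:Z - i%:Z).
Proof.
move=> ij jn; apply: (slope_chain h_slope (leq_pred n)) => //; last by lia.
by move=> k kn /=; rewrite /adjacent; do ?case: ifP; lia.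
Qed.

Lemma slope_fork : h n <= h n.-2 <= h n + 1.
Proof. by apply: h_slope; [lia|lia|rewrite /= /adjacent; do ?case: ifP; lia]. Qed.

Section Vector.
Hypothesis N_bound : (0 < N <= n.-2)%N.
Hypothesis h_r0 : h N <= r0.

(** The boxes 1, ..., n, n + 1, ..., 2n are those of the vector representation, in
which n and n + 1 are incomparable. A column may hold them next to each other in
either order, and decreases otherwise. *)
Definition fork_column (a : int -> int) : Prop :=
  (forall r, r < r0 -> 2 * n%:Z < a r) /\
  (forall r, r0 <= r ->
     [|| a (r + 1) < a r | (a r == n%:Z) && (a (r + 1) == n%:Z + 1)] /\
     N%:Z + r0 - r <= a r).

(** Each label has two arrows. For i < n they are i -> i + 1 and its dual
2n - i -> 2n + 1 - i; for i = n they are the two arrows n - 1 -> n + 1 and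
n -> n + 2 around the fork. The shift i - n + 1 makes the dual arrow simultaneous
with the first one; it vanishes for i = n - 1, whose two arrows enter and leave
the fork. *)
Definition fork_sum (G : int -> int -> int -> int) (i : nat) (r : int) : int :=
  if i == n then G (n%:Z - 1) (n%:Z + 1) r + G n%:Z (n%:Z + 2) r
  else G i%:Z (i%:Z + 1) r
    + G (2 * n%:Z - i%:Z) (2 * n%:Z - i%:Z + 1) (r + (i%:Z - n%:Z + 1)).

Definition vector_coef (a : int -> int) : nat -> int -> int := fork_sum (gap a).

(** The arrows of the crystal, with label, source, target and shift. *)
Inductive fork_edge : nat -> int -> int -> int -> Prop :=
  | LowEdge i : (0 < i < n)%N -> fork_edge i i%:Z (i%:Z + 1) 0
  | HighEdge i : (0 < i < n)%N ->
      fork_edge i (2 * n%:Z - i%:Z) (2 * n%:Z - i%:Z + 1) (i%:Z - n%:Z + 1)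
  | ForkLow : fork_edge n (n%:Z - 1) (n%:Z + 1) 0
  | ForkHigh : fork_edge n n%:Z (n%:Z + 2) 0.

Lemma vector_coefP (a : int -> int) (i : nat) (r : int) : (0 < i <= n)%N ->
  exists v1 w1 o1 v2 w2 o2, [/\ fork_edge i v1 w1 o1, fork_edge i v2 w2 o2 &
    vector_coef a i r = gap a v1 w1 (r + o1) + gap a v2 w2 (r + o2)].
Proof.
move=> Hi; rewrite /vector_coef /fork_sum; have [->|iNn] := eqVneq i n.
  exists (n%:Z - 1), (n%:Z + 1), 0, n%:Z, (n%:Z + 2), 0.
  by rewrite !addr0; split=> //; constructor.
exists i%:Z, (i%:Z + 1), 0, (2 * n%:Z - i%:Z), (2 * n%:Z - i%:Z + 1), (i%:Z - n%:Z + 1).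
by rewrite addr0; split=> //; constructor; lia.
Qed.

Lemma fork_edge_beta (i : nat) (v w o r : int) (j : nat) (u : int) :
    fork_edge i v w o -> (0 < j <= n)%N ->
  fork_sum (jump v w (r + o)) j u = grid_beta TypeD n i r j u.
Proof.
clear h_slope N_bound h_r0; move=> e Hj.
rewrite /fork_sum /jump /grid_beta /= /adjacent.
by case: e => [k Hk|k Hk||]; decide_atoms.
Qed.

Lemma vector_change (a : int -> int) (x v w : int) (j : nat) (u : int) : a x = v ->
  vector_coef (change a x w) j u = vector_coef a j u - fork_sum (jump v w x) j u.
Proof.
move=> ax; rewrite /vector_coef /fork_sum; case: ifP => _;
  by rewrite !(gap_change _ _ _ _ ax); ring.
Qed.

Lemma fork_sum_jumpC (v w x : int) (j : nat) (u : int) :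
  fork_sum (jump w v x) j u = - fork_sum (jump v w x) j u.
Proof. by rewrite /fork_sum; case: ifP => _; rewrite !(jumpC v w); ring. Qed.

(** Away from the fork this is the argument for strict columns. At the fork, moving
n to n + 2 past a predecessor n + 1, or n + 1 to n + 2 past a predecessor n,
would break the column; but then the other arrow with the same label contributes
-1, against the positivity of the total. *)
Lemma fork_column_raise (a : int -> int) (i : nat) (v w o r : int) :
    fork_column a -> fork_edge i v w o -> 0 < gap a v w (r + o) -> 0 < vector_coef a i r ->
  a (r + o) = v /\ fork_column (change a (r + o) w).
Proof.
move=> [big dec] e g_gt0 F_gt0.
have ar : a (r + o) = v by move: g_gt0; rewrite /gap; lia.
have ar1 : a (r + o - 1) != w by move: g_gt0; rewrite /gap; lia.
have v_le : v <= 2 * n%:Z by case: e {g_gt0 F_gt0 ar ar1} => [k Hk|k Hk||]; lia.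
have r0r : r0 <= r + o by case: (lerP r0 (r + o)) => // /big; lia.
split=> //; split=> u; rewrite /change.
  by move=> ur; have -> : (u == r + o) = false by [lia]; exact: big.
move=> r0u; have [dec1 low] := dec u r0u.
have [ur|ur] := eqVneq u (r + o).
  have -> : (u + 1 == r + o) = false by lia.
  rewrite ur in dec1 low *; rewrite ar in dec1 low.
  by case: e {g_gt0 F_gt0} dec1 low ar ar1 v_le => [k Hk|k Hk||]; lia.
have [u1r|//] := eqVneq (u + 1) (r + o).
rewrite u1r ar in dec1; have ur1 : u = r + o - 1 by lia.
rewrite -ur1 in ar1; split=> //.
move: F_gt0 g_gt0; rewrite /vector_coef /fork_sum /gap -ur1 ar.
case: e u1r ur1 dec1 ar1 ar => [k Hk|k Hk||] /=; last 2 first.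
- by rewrite eqxx addr0 => u1r ->; lia.
- by rewrite eqxx addr0 => u1r ->; lia.
- have -> : (k == n) = false by lia.
  rewrite addr0 => u1r -> dec1 ar1 ar.
  by rewrite ar; lia.
have -> : (k == n) = false by lia.
have [k_eq|k_neq] := eqVneq k n.-1; last by move=> _ _ dec1 ar1 _ _ _; lia.
have -> : k%:Z - n%:Z + 1 = 0 by lia.
rewrite !addr0 => u1r -> dec1 ar1 ar.
by rewrite ar; lia.
Qed.

(** As for raising, the sign of the total excludes the two bad neighbours at the
fork. The bound drawn from the lower bound on the entries is stated for sources
below the fork; for the other arrows r0 <= r - 1 + o is strong enough. *)
Lemma fork_column_lower (a : int -> int) (i : nat) (v w o r : int) :
    fork_column a -> fork_edge i v w o -> gap a v w (r + o) < 0 -> vector_coef a i r < 0 ->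
  [/\ a (r - 1 + o) = w, r0 <= r - 1 + o, v < n%:Z - 1 -> N%:Z + r0 - v <= r - 1 + o
    & fork_column (change a (r - 1 + o) v)].
Proof.
move=> [big dec] e g_lt0 F_lt0.
have ro : r + o - 1 = r - 1 + o by lia.
have ar : a (r + o) != v by move: g_lt0; rewrite /gap; lia.
have ar1 : a (r - 1 + o) = w by move: g_lt0; rewrite /gap ro; lia.
have w_le : w <= 2 * n%:Z by case: e {g_lt0 F_lt0 ar ar1} => [k Hk|k Hk||]; lia.
have r0r : r0 <= r - 1 + o by case: (lerP r0 (r - 1 + o)) => // /big; lia.
have ro1 : r - 1 + o + 1 = r + o by lia.
have [decr _] := dec _ r0r; rewrite ro1 ar1 in decr.
have [_ lowr] := dec (r + o) ltac:(lia).
have below : [|| a (r + o) < v | (v == n%:Z) && (a (r + o) == n%:Z + 1)].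
  move: F_lt0 g_lt0; rewrite /vector_coef /fork_sum /gap ro.
  case: e ar ar1 decr {ro1 lowr r0r w_le ro} => [k Hk|k Hk||] /=; last 2 first.
  - by rewrite eqxx !addr0 => ar ar1 decr; lia.
  - by rewrite eqxx !addr0 => ar ar1 decr; lia.
  - have -> : (k == n) = false by lia.
    have [k_eq|k_neq] := eqVneq k n.-1; last first.
      by rewrite !addr0 => ar ar1 decr; lia.
    have -> : k%:Z - n%:Z + 1 = 0 by lia.
    by rewrite !addr0 => ar ar1 decr; lia.
  have -> : (k == n) = false by lia.
  have [k_eq|k_neq] := eqVneq k n.-1; last by move=> ar ar1 decr; lia.
  have -> : k%:Z - n%:Z + 1 = 0 by lia.
  by rewrite !addr0 => ar ar1 decr; lia.
split=> //; first by lia.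
split=> u; rewrite /change.
  by move=> ur; have -> : (u == r - 1 + o) = false by [lia]; exact: big.
move=> r0u; have [dec1 low] := dec u r0u.
have [ur|ur] := eqVneq u (r - 1 + o).
  have -> : (u + 1 == r - 1 + o) = false by lia.
  by rewrite ur ro1; split=> //; lia.
have [u1r|//] := eqVneq (u + 1) (r - 1 + o).
rewrite u1r ar1 in dec1; split=> //.
by case: e {F_lt0 g_lt0 below decr ar ar1 w_le} dec1 => [k Hk|k Hk||]; lia.
Qed.

Lemma stable_typeD_vector : stable_start TypeD n h N r0.
Proof.
have h_node i : (0 < i <= n)%N ->
    h i <= r0 + Num.max 0 (n%:Z - 1 - i%:Z) /\
    (i%:Z < n%:Z - 1 -> forall r, r0 <= r -> N%:Z + r0 - i%:Z <= r -> h i <= r).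
  move=> Hi; have fork := slope_fork; have N_last := @slope_chainD N n.-2.
  have := N_last ltac:(lia) ltac:(lia); case: (ltnP i n) => iN; last first.
    by have -> : i = n by [lia]; split; lia.
  case: (leqP i N) => iN'; [have := @slope_chainD i N | have := @slope_chainD N i].
    by move=> /(_ ltac:(lia) ltac:(lia)) ? ?; split=> [|? r]; lia.
  by move=> /(_ ltac:(lia) ltac:(lia)) ? ?; split=> [|? r]; lia.
exists (fun f => exists2 a, fork_column a &
  forall j u, (0 < j <= n)%N -> f j u = (vector_coef a j u)%:~R); split.
  apply: (stable_of_unit_steps (F := vector_coef)).
    move=> a i r col Hi F_gt0.
    have [v1 [w1 [o1 [v2 [w2 [o2 [e1 e2 F_eq]]]]]]] := vector_coefP a r Hi.
    have /orP[g_gt0|g_gt0] : (0 < gap a v1 w1 (r + o1)) || (0 < gap a v2 w2 (r + o2)).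
    - by move: F_gt0; rewrite F_eq; lia.
    - have [ar col'] := fork_column_raise col e1 g_gt0 F_gt0.
      by exists (change a (r + o1) w1) => // j u Hj;
        rewrite (vector_change _ _ _ ar) (fork_edge_beta _ _ e1).
    have [ar col'] := fork_column_raise col e2 g_gt0 F_gt0.
    by exists (change a (r + o2) w2) => // j u Hj;
        rewrite (vector_change _ _ _ ar) (fork_edge_beta _ _ e2).
  have step a i r v w o : fork_column a -> (0 < i <= n)%N -> vector_coef a i r < 0 ->
      fork_edge i v w o -> gap a v w (r + o) < 0 ->
      h i <= r - 1 /\ exists2 a', fork_column a' & forall j u, (0 < j <= n)%N ->
        vector_coef a' j u = vector_coef a j u + grid_beta TypeD n i (r - 1) j u.
    move=> col Hi F_lt0 e g_lt0.
    have [ar low1 low2 col'] := fork_column_lower col e g_lt0 F_lt0.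
    split; last first.
      exists (change a (r - 1 + o) v) => // j u Hj.
      by rewrite (vector_change _ _ _ ar) fork_sum_jumpC opprK (fork_edge_beta _ _ e).
    have [h1 h2] := h_node i Hi.
    case: e low1 low2 {g_lt0 F_lt0 ar col'} Hi h1 h2 => [k Hk|k Hk||] low1 low2 Hi h1 h2; try lia.
    have [k_lt|] := ltrP k%:Z (n%:Z - 1); last by lia.
    by apply: h2 => //; lia.
  move=> a i r col Hi F_lt0.
  have [v1 [w1 [o1 [v2 [w2 [o2 [e1 e2 F_eq]]]]]]] := vector_coefP a r Hi.
  have /orP[g_lt0|g_lt0] : (gap a v1 w1 (r + o1) < 0) || (gap a v2 w2 (r + o2) < 0).
  - by move: F_lt0; rewrite F_eq; lia.
  - exact: step e1 g_lt0.
  exact: step e2 g_lt0.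
move=> f f0; exists (top_column (2 * n) N r0).
  by split=> r rr; rewrite /top_column; do ?case: ifP; lia.
move=> j u Hj; rewrite f0 // /vector_coef /fork_sum.
have top_gap v w r : v < w -> w <= 2 * n%:Z -> N%:Z < v ->
    gap (top_column (2 * n) N r0) v w r = 0.
  by move=> vw wn Nv; rewrite /gap /top_column; do ?case: ifP; lia.
case: (j =P n) => jn.
  have -> : (j == N) = false by lia.
  by rewrite !top_gap //; lia.
by rewrite gap_top ?eqz_nat ?top_gap ?addr0 //; lia.
Qed.

End Vector.

(** * Type D: the spin representations *)

Section Spin.
Hypothesis N_bound : (n.-1 <= N <= n)%N.
Hypothesis h_r0 : h N <= r0.

(** The spin node at which the row of index r starts: the rows start alternately
at N and at the other of the nodes n - 1 and n. *)
Definition tip (r : int) : nat :=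
  if ((r - r0) %% 2)%Z == 0 then N else (2 * n - 1 - N)%N.

Lemma tip_bound (r : int) : (n.-1 <= tip r <= n)%N.
Proof. by rewrite /tip; case: ifP; lia. Qed.

Lemma tip0 : tip r0 = N.
Proof. by rewrite /tip subrr. Qed.

Lemma tipS (r : int) : tip (r + 1) = (2 * n - 1 - tip r)%N.
Proof. by rewrite /tip; do 2![case: ifP]; lia. Qed.

(** Row r has applied beta at its tip, then at n - 2, n - 3, ..., for a total of d r
nodes. Row r may start once row r - 1 has passed node n - 2, which explains the
threshold 2; a row of length 1 contributes -1 at its own tip,
one place later. *)
Definition spin_coef (d : int -> int) (i : nat) (r : int) : int :=
  if (i < n.-1)%N then
    gap (fun u => d (u - (n%:Z - 1 - i%:Z))) (n%:Z - 1 - i%:Z) (n%:Z - i%:Z) r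
  else if i == tip r then ((2 <= d (r - 1))%R)%:Z - ((1 <= d r)%R)%:Z
  else - (d (r - 1) == 1)%:Z.

(** The loss of [spin_coef] when the row at x passes from length v0 to v1. *)
Definition spin_jump (v0 v1 x : int) (i : nat) (r : int) : int :=
  if (i < n.-1)%N then
    jump v0 v1 (x + (n%:Z - 1 - i%:Z)) (n%:Z - 1 - i%:Z) (n%:Z - i%:Z) r
  else if i == tip r then
    ((r == x + 1) && (2 <= v0)%R)%:Z - ((r == x + 1) && (2 <= v1)%R)%:Z
    - ((r == x) && (1 <= v0)%R)%:Z + ((r == x) && (1 <= v1)%R)%:Z
  else ((r == x + 1) && (v1 == 1))%:Z - ((r == x + 1) && (v0 == 1))%:Z.

Lemma spin_jumpC (v0 v1 x : int) (i : nat) (r : int) :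
  spin_jump v1 v0 x i r = - spin_jump v0 v1 x i r.
Proof.
by rewrite /spin_jump (jumpC v0); do ?case: ifP => _ //; ring.
Qed.

Lemma spin_change (d : int -> int) (x v0 v1 : int) (i : nat) (r : int) : d x = v0 ->
  spin_coef (change d x v1) i r = spin_coef d i r - spin_jump v0 v1 x i r.
Proof.
move=> dx; rewrite /spin_coef /spin_jump; case: ifP => _.
  set e := n%:Z - 1 - i%:Z.
  have -> : gap (fun u => change d x v1 (u - e)) e (n%:Z - i%:Z) r =
      gap (change (fun u => d (u - e)) (x + e) v1) e (n%:Z - i%:Z) r.
    rewrite /gap /change; have -> : (r - e == x) = (r == x + e) by lia.
    by have -> : (r - 1 - e == x) = (r - 1 == x + e) by lia.
  by apply: gap_change; rewrite addrK.
rewrite /change; have -> : (r - 1 == x) = (r == x + 1) by lia.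
case: ifP => _; case: (r =P x) => [->|_]; case: (_ =P x + 1) => [E|_]; try lia;
  by rewrite E addrK; lia.
Qed.

Lemma spin_beta (e r : int) (j : nat) (u : int) (i : nat) :
    (0 < j <= n)%N -> (0 < i < n.-1)%N -> e = n%:Z - 1 - i%:Z ->
  spin_jump e (e + 1) (r - e) j u = grid_beta TypeD n i r j u.
Proof.
clear h_slope N_bound h_r0; move=> Hj Hi ->.
rewrite /spin_jump /jump /grid_beta /= /adjacent.
by case: (j == tip u); decide_atoms.
Qed.

Lemma spin_beta_tip (r : int) (j : nat) (u : int) : (0 < j <= n)%N ->
  spin_jump 0 1 r j u = grid_beta TypeD n (tip r) r j u.
Proof.
move=> Hj; have tip_r := tip_bound r; have tip_r1 := tipS r.
rewrite /spin_jump /jump /grid_beta /= /adjacent.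
clear h_slope N_bound h_r0.
case: (u =P r) => [->|ur]; last case: (u =P r + 1) => [->|ur1].
- by decide_atoms.
- by rewrite tip_r1; decide_atoms.
by decide_atoms.
Qed.

(** The rows before r0 are filled (length at least n), and from r0 on they form a
strict partition followed by zeros. *)
Definition strict_rows (d : int -> int) : Prop :=
  (forall r, r < r0 -> n%:Z <= d r) /\
  (forall r, r0 <= r ->
     0 <= d r /\ [|| d (r + 1) < d r | (d r == 0) && (d (r + 1) == 0)]).

Lemma strict_rows_change (d : int -> int) (x v : int) :
    strict_rows d -> r0 <= x -> 0 <= v ->
    [|| d (x + 1) < v | (v == 0) && (d (x + 1) == 0)] ->
    (r0 <= x - 1 -> v < d (x - 1)) -> strict_rows (change d x v).
Proof.
move=> [big dec] r0x v_ge0 below above; split=> u; rewrite /change.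
  by move=> ur; have -> : (u == x) = false by [lia]; exact: big.
move=> r0u; have [d_ge0 dec_u] := dec u r0u.
have [ux|ux] := eqVneq u x.
  by have -> : (u + 1 == x) = false by [lia]; rewrite ux.
have [u1x|//] := eqVneq (u + 1) x.
have ux1 : u = x - 1 by lia.
by rewrite ux1 in d_ge0 dec_u r0u *; have := above r0u; split; lia.
Qed.

Lemma spin_raise (d : int -> int) (i : nat) (r : int) :
    strict_rows d -> (0 < i <= n)%N -> 0 < spin_coef d i r ->
  exists2 d', strict_rows d' & forall j u, (0 < j <= n)%N ->
    spin_coef d' j u = spin_coef d j u - grid_beta TypeD n i r j u.
Proof.
move=> rows Hi; have [big dec] := rows; rewrite {1}/spin_coef; case: ifP => i_lt.
  set e := n%:Z - 1 - i%:Z; rewrite /gap => F_gt0.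
  have dx : d (r - e) = e by lia.
  have dx1 : d (r - e - 1) != n%:Z - i%:Z.
    by have -> : r - e - 1 = r - 1 - e by [lia]; lia.
  have r0x : r0 <= r - e by case: (lerP r0 (r - e)) => // /big; lia.
  have [_ below] := dec _ r0x.
  exists (change d (r - e) (e + 1)).
    apply: strict_rows_change => //; [lia|lia|].
    by move=> /dec[_]; rewrite subrK; lia.
  by move=> j u Hj; rewrite (spin_change _ _ _ dx) (@spin_beta e r j u i) //; lia.
case: ifP => [/eqP i_tip F_gt0|_]; last by lia.
have r0r : r0 <= r by case: (lerP r0 r) => // /big; lia.
have [d_ge0 below] := dec _ r0r.
have dr : d r = 0 by lia.
exists (change d r 1); first by apply: strict_rows_change => //; lia.
by move=> j u Hj; rewrite (spin_change _ _ _ dr) spin_beta_tip // -i_tip.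
Qed.

(** At the tip of row r the coefficient is never negative, because a nonempty row is
shorter than its predecessor. At the other spin node it is negative when row
r - 1 has length 1, and this row is then removed; if r - 1 > r0, the node may differ
from N, and its height exceeds h N by at most one. *)
Lemma spin_lower (d : int -> int) (i : nat) (r : int) :
    strict_rows d -> (0 < i <= n)%N -> spin_coef d i r < 0 ->
  h i <= r - 1 /\
  exists2 d', strict_rows d' & forall j u, (0 < j <= n)%N ->
    spin_coef d' j u = spin_coef d j u + grid_beta TypeD n i (r - 1) j u.
Proof.
move=> rows Hi; have [big dec] := rows.
have h_spin : h N <= h n.-2 <= h N + 1 /\ h (2 * n - 1 - N)%N <= h n.-2.
  have := slope_fork; have := @slope_chainD n.-2 n.-1 ltac:(lia) ltac:(lia).
  have [->|NNn] := eqVneq N n; first by have -> : (2 * n - 1 - n = n.-1)%N by [lia]; lia.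
  have -> : N = n.-1 by lia.
  by have -> : (2 * n - 1 - n.-1 = n)%N by [lia]; lia.
rewrite {1}/spin_coef; case: ifP => i_lt.
  have := @slope_chainD i n.-2 ltac:(lia) ltac:(lia).
  set e := n%:Z - 1 - i%:Z; rewrite /gap => h_i F_lt0.
  have dx1 : d (r - 1 - e) = e + 1 by lia.
  have r0x : r0 <= r - 1 - e by case: (lerP r0 (r - 1 - e)) => // /big; lia.
  have x1 : r - 1 - e + 1 = r - e by lia.
  have [_ below] := dec _ r0x; rewrite x1 in below.
  split; first by lia.
  exists (change d (r - 1 - e) e).
    apply: strict_rows_change => //; [lia|by rewrite x1; lia|].
    by move=> /dec[_]; rewrite subrK; lia.
  move=> j u Hj; rewrite (spin_change _ _ _ dx1) spin_jumpC opprK.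
  by rewrite (@spin_beta e (r - 1) j u i) //; lia.
have [dec_r|small_r] : (r0 <= r - 1) \/ (r - 1 < r0) by lia.
  have [d_ge0 below] := dec _ dec_r; rewrite subrK in below.
  case: ifP => [_ F_lt0|/eqP i_tip F_lt0]; first by lia.
  have dr : d (r - 1) = 1 by lia.
  have := tipS (r - 1); have := tip_bound (r - 1); rewrite subrK => tb tS.
  have i_tip' : i = tip (r - 1) by lia.
  split.
    have [r_eq|r_neq] := eqVneq (r - 1) r0; first by rewrite i_tip' r_eq tip0.
    by move: h_spin; rewrite i_tip' /tip; case: ifP; lia.
  exists (change d (r - 1) 0).
    apply: strict_rows_change => //; first by rewrite subrK; lia.
    by move=> /dec[_]; rewrite subrK; lia.
  move=> j u Hj; rewrite (spin_change _ _ _ dr) spin_jumpC opprK.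
  by rewrite spin_beta_tip // -i_tip'.
by have := big _ small_r; case: ifP => _; lia.
Qed.

Lemma stable_typeD_spin : stable_start TypeD n h N r0.
Proof.
exists (fun f => exists2 d, strict_rows d &
  forall j u, (0 < j <= n)%N -> f j u = (spin_coef d j u)%:~R); split.
  apply: (stable_of_unit_steps (F := spin_coef)); [exact: spin_raise | exact: spin_lower].
move=> f f0; exists (fun r => if r < r0 then n%:Z else 0).
  by split=> r rr; do ?case: ifP; lia.
move=> j u Hj; rewrite f0 //.
suff -> : spin_coef (fun r => if r < r0 then n%:Z else 0) j u
    = ((j == N) && (u == r0))%:Z by [].
rewrite /spin_coef /gap; case: ifP => j_lt; first by do 2![case: ifP]; lia.
case: ifP => [/eqP j_tip|/eqP j_tip].
  have [u_eq|u_neq] := eqVneq u r0; last by do 2![case: ifP]; lia.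
  by rewrite u_eq in j_tip *; rewrite j_tip tip0 eqxx; do 2![case: ifP]; lia.
have -> : (j == N) && (u == r0) = false.
  by apply/negP => /andP[/eqP jN /eqP ur]; rewrite ur tip0 in j_tip.
by case: ifP; lia.
Qed.

End Spin.
End TypeD.

Theorem theorem3p8 (X : cartan_type) (n : nat) (hn : valid_rank X n)
    (s : index_seq n) (hs : adapted X s) :
  positivity_condition X s.
Proof.
apply: positivity_of_stable => // i0 r0 Hi hr0; have sl := height_slope hs hn.
case: X hn {hs} hr0 sl => /= n_big hr0 sl.
- exact: stable_typeA.
- exact: stable_typeB.
- exact: stable_typeC.
- have [i_le|i_gt] := leqP i0 n.-2; first by apply: stable_typeD_vector => //; lia.
  by apply: stable_typeD_spin => //; lia.
Qed.
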